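(* Let $\Gamma \cup \{A\} \subseteq \mathcal{L}$. Then, for the $iS4h$ calculus, the following are equivalent: (a) $\Gamma \vdash A$; (b) $\Gamma \Vdash_i A$, i.e. for every interior preorder model $\mathcal{M}$ on an interior preorder frame $(X, \leq, i)$ and every $x \in X$, if $\mathcal{M}, x \Vdash B$ for every $B \in \Gamma$, then $\mathcal{M}, x \Vdash A$; (c) $\Gamma \Vdash_{\mathcal{S}} A$ for coherent neighbourhood systems, i.e. for every coherent neighbourhood system $\mathcal{S} = (X, \leq, N)$, every neighbourhood model $\mathcal{M}$ for $\mathcal{S}$ and every $x \in X$, if $\mathcal{M}, x \Vdash B$ for every $B \in \Gamma$, then $\mathcal{M}, x \Vdash A$.
   Context: Language: $\mathcal{L}_0$ is a countable set of propositional variables; $\mathcal{L}$ is the set of formulas built from $\mathcal{L}_0 \cup \{\bot\}$ with the binary connectives $\lor, \land, \to$ and the unary connective $\Box$. The $iS4h$ calculus. Axioms, for $p,q,r \in \mathcal{L}_0$: $(A_1)$ $p \to (q \to p)$; $(A_2)$ $(p \to (q \to r)) \to ((p \to q) \to (p \to r))$; $(A_3)$ $p \to (p \lor q)$; $(A_4)$ $q \to (p \lor q)$; $(A_5)$ $(p \to r) \to ((q \to r) \to ((p \lor q) \to r))$; $(A_6)$ $p \land q \to p$; $(A_7)$ $p \land q \to q$; $(A_8)$ $(p \to q) \to ((p \to r) \to (p \to (q \land r)))$; $(A_9)$ $\bot \to p$; $(K)$ $\Box(p \to q) \to (\Box p \to \Box q)$; $(T)$ $\Box p \to p$; $(4)$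 $\Box p \to \Box\Box p$. The relation $\Gamma \vdash A$ is generated by the rules: (Ax) if $A$ is an axiom then $\Gamma \vdash A$; (C) if $A \in \Gamma$ then $\Gamma \vdash A$; (MP) if $\Gamma \vdash A$ and $\Gamma \vdash A \to B$ then $\Gamma \vdash B$; (US) if $\varnothing \vdash A$ then $\Gamma \vdash A'$ for any uniform substitution instance $A'$ of $A$; (G) if $\varnothing \vdash A$ then $\Gamma \vdash \Box A$. Frames. A preordered set $(X, \leq)$ is a set with a reflexive transitive relation. An upset is a subset $U \subseteq X$ such that $x \in U$ and $x \leq y$ imply $y \in U$; $\mu(X)$ is the set of all upsets, a Heyting algebra under $\cup, \cap, \varnothing, X$ and $a \rhd b = \{x \in X \mid \text{for every } y \in X,\ \text{if } x \leq y \text{ and } y \in a \text{ then } y \in b\}$. For $i : \mu(X) \to \mu(X)$ consider, for all $a, b \in \mu(X)$: $(I_1)$ $i(a) \subseteq a$; $(I_2)$ $i(a) \subseteq i(i(a))$; $(I_3)$ $i(a \cap b) = i(a) \cap i(b)$; $(I_4)$ $i(X) = X$. An interior preorder frame is a triple $(X, \leq, i)$ where $(X,\leq)$ is a preordered set and $i$ satisfies $(I_1)$–$(I_4)$. A neighbourhood space (also called neighbourhood system) is a triple $(X, \leq, N)$ where $(X,\leq)$ is a preordered set and $N : X \to \mathcal{P}(\mu(X))$, $x \mapsto N_x$, satisfies $N_x \subseteq N_y$ whenever $x \leq y$. For $U \subseteq X$ put $i_N(U) = \{x \in X \mid U \in N_x\}$; $i_N$ maps $\mu(X)$ into $\mu(X)$.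 The system is filtered if for every $x \in X$ and $U, V \in \mu(X)$: ($U \in N_x$ and $V \in N_x$) if and only if $U \cap V \in N_x$. A filtered neighbourhood system is coherent if $i_N$ satisfies $(I_1)$ and $(I_2)$. Models. A model on an interior preorder frame (an interior preorder model), respectively on a neighbourhood system (a neighbourhood model), is given by a valuation $v : \mathcal{L}_0 \to \mu(X)$, extended to $V : \mathcal{L} \to \mu(X)$ by $V|_{\mathcal{L}_0} = v$, $V(\bot) = \varnothing$, $V(A \land B) = V(A) \cap V(B)$, $V(A \lor B) = V(A) \cup V(B)$, $V(A \to B) = V(A) \rhd V(B)$, and $V(\Box A) = i(V(A))$, respectively $V(\Box A) = i_N(V(A))$. One writes $\mathcal{M}, x \Vdash A$ if $x \in V(A)$.
   Formalization: In a filtered neighbourhood system each N_x is also required to be nonempty (otherwise N_x = ∅ gives a coherent system refuting the derivable □(⊥→⊥)), and the set of propositional variables is required to have at least three elements (with none, ⊥→⊥ is valid but underivable). *)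

(* Defs.v *)
From mathcomp Require Import all_boot.
From mathcomp Require Import boolp classical_sets.
From Corelib Require Export RelationClasses.

Set Implicit Arguments.
Unset Strict Implicit.
Unset Printing Implicit Defensive.

Local Open Scope classical_set_scope.

Inductive formula (L0 : Type) : Type :=
| Var (p : L0)
| Bot
| Or (A B : formula L0)
| And (A B : formula L0)
| Imp (A B : formula L0)
| Box (A : formula L0).

Arguments Bot {L0}.

Declare Scope formula_scope.
Delimit Scope formula_scope with F.
Bind Scope formula_scope with formula.
Notation "A || B" := (Or A B) : formula_scope.
Notation "A && B" := (And A B) : formula_scope.
Notation "A ==> B" := (Imp A B) : formula_scope.

Fixpoint subst (L0 : Type) (s : L0 -> formula L0) (A : formula L0) :
    formula L0 :=
  match A with
  | Var p => s p
  | Bot => Bot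
  | Or A B => subst s A || subst s B
  | And A B => subst s A && subst s B
  | Imp A B => subst s A ==> subst s B
  | Box A => Box (subst s A)
  end%F.

(* The axioms are stated for propositional variables only; their instances
   are obtained with the rule of uniform substitution. *)
Inductive iS4h_axiom (L0 : Type) : formula L0 -> Prop :=
| ax_A1 p q : iS4h_axiom (Var p ==> (Var q ==> Var p))
| ax_A2 p q r : iS4h_axiom
    ((Var p ==> (Var q ==> Var r)) ==>
     ((Var p ==> Var q) ==> (Var p ==> Var r)))
| ax_A3 p q : iS4h_axiom (Var p ==> (Var p || Var q))
| ax_A4 p q : iS4h_axiom (Var q ==> (Var p || Var q))
| ax_A5 p q r : iS4h_axiom
    ((Var p ==> Var r) ==>
     ((Var q ==> Var r) ==> ((Var p || Var q) ==> Var r)))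
| ax_A6 p q : iS4h_axiom ((Var p && Var q) ==> Var p)
| ax_A7 p q : iS4h_axiom ((Var p && Var q) ==> Var q)
| ax_A8 p q r : iS4h_axiom
    ((Var p ==> Var q) ==>
     ((Var p ==> Var r) ==> (Var p ==> (Var q && Var r))))
| ax_A9 p : iS4h_axiom (Bot ==> Var p)
| ax_K p q : iS4h_axiom
    (Box (Var p ==> Var q) ==> (Box (Var p) ==> Box (Var q)))
| ax_T p : iS4h_axiom (Box (Var p) ==> Var p)
| ax_4 p : iS4h_axiom (Box (Var p) ==> Box (Box (Var p))).

Inductive derives (L0 : Type) : set (formula L0) -> formula L0 -> Prop :=
| rule_Ax Gamma A : iS4h_axiom A -> derives Gamma A
| rule_C (Gamma : set (formula L0)) A : Gamma A -> derives Gamma A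
| rule_MP Gamma A B :
    derives Gamma A -> derives Gamma (A ==> B) -> derives Gamma B
| rule_US Gamma A s : derives set0 A -> derives Gamma (subst s A)
| rule_G Gamma A : derives set0 A -> derives Gamma (Box A).

Structure preordered_set := PreorderedSet {
  carrier :> Type;
  le : carrier -> carrier -> Prop;
  le_preorder : PreOrder le
}.

Definition is_upset (X : preordered_set) (U : set X) : Prop :=
  forall x y, U x -> le x y -> U y.

Record upset (X : preordered_set) := Upset {
  upset_set :> set X;
  upsetP : is_upset upset_set
}.

Section HeytingAlgebraOfUpsets.
Variable X : preordered_set.
Implicit Types a b : upset X.

Lemma is_upset0 : is_upset (set0 : set X).
Proof. by []. Qed.

Lemma is_upsetT : is_upset (setT : set X).
Proof. by []. Qed.

Lemma is_upsetI a b : is_upset (a `&` b).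
Proof.
by move=> x y [ax bx] xy; split; [exact: upsetP ax xy|exact: upsetP bx xy].
Qed.

Lemma is_upsetU a b : is_upset (a `|` b).
Proof.
by move=> x y [ax|bx] xy; [left; exact: upsetP ax xy|right; exact: upsetP bx xy].
Qed.

Lemma is_upset_rhd a b :
  is_upset [set x : X | forall y, le x y -> upset_set a y -> upset_set b y].
Proof.
move=> x y xab xy z yz; apply: xab.
exact: (@PreOrder_Transitive _ _ (le_preorder X)) xy yz.
Qed.

Definition upset0 : upset X := Upset is_upset0.
Definition upsetT : upset X := Upset is_upsetT.
Definition upsetI a b : upset X := Upset (@is_upsetI a b).
Definition upsetU a b : upset X := Upset (@is_upsetU a b).
Definition upset_rhd a b : upset X := Upset (@is_upset_rhd a b).

End HeytingAlgebraOfUpsets.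

Section InteriorConditions.
Variables (X : preordered_set) (i : upset X -> upset X).

Definition I1 : Prop := forall a, i a `<=` a.
Definition I2 : Prop := forall a, i a `<=` i (i a).
Definition I3 : Prop := forall a b, i (upsetI a b) = i a `&` i b :> set X.
Definition I4 : Prop := i (upsetT X) = setT :> set X.

End InteriorConditions.

Structure interior_preorder_frame := InteriorPreorderFrame {
  frame_set :> preordered_set;
  interior : upset frame_set -> upset frame_set;
  interior_I1 : I1 interior;
  interior_I2 : I2 interior;
  interior_I3 : I3 interior;
  interior_I4 : I4 interior
}.

Structure nbhd_system := NbhdSystem {
  nbhd_set :> preordered_set;
  nbhd : nbhd_set -> set (upset nbhd_set);
  nbhd_mono : forall x y, le x y -> nbhd x `<=` nbhd y
}.

Lemma is_upset_nbhd_interior (S : nbhd_system) (U : upset S) :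
  is_upset [set x : S | nbhd x U].
Proof. by move=> x y xU xy; exact: nbhd_mono xy _ xU. Qed.

Definition nbhd_interior (S : nbhd_system) (U : upset S) : upset S :=
  Upset (@is_upset_nbhd_interior S U).

(* Each [nbhd x] is a filter, in particular nonempty. The nonemptiness does not
   follow from the second clause, and it is what makes [nbhd_interior] satisfy
   [I4]: a system with [nbhd x = set0] for every [x] satisfies the second
   clause, [I1] and [I2] but invalidates [Box (Bot ==> Bot)]. *)
Definition filtered (S : nbhd_system) : Prop :=
  forall x : S, nbhd x !=set0 /\
    forall U V : upset S, nbhd x U /\ nbhd x V <-> nbhd x (upsetI U V).

Definition coherent (S : nbhd_system) : Prop :=
  [/\ filtered S, I1 (@nbhd_interior S) & I2 (@nbhd_interior S)].

Fixpoint truth_set (L0 : Type) (X : preordered_set) (i : upset X -> upset X)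
    (v : L0 -> upset X) (A : formula L0) : upset X :=
  match A with
  | Var p => v p
  | Bot => upset0 X
  | Or A B => upsetU (truth_set i v A) (truth_set i v B)
  | And A B => upsetI (truth_set i v A) (truth_set i v B)
  | Imp A B => upset_rhd (truth_set i v A) (truth_set i v B)
  | Box A => i (truth_set i v A)
  end.

Structure interior_preorder_model (L0 : Type) := InteriorPreorderModel {
  model_frame :> interior_preorder_frame;
  model_val : L0 -> upset model_frame
}.

Definition interior_forces (L0 : Type) (M : interior_preorder_model L0)
    (x : M) (A : formula L0) : Prop :=
  upset_set (truth_set (@interior M) (@model_val L0 M) A) x.

Definition nbhd_model (L0 : Type) (S : nbhd_system) : Type := L0 -> upset S.

Definition nbhd_forces (L0 : Type) (S : nbhd_system) (M : nbhd_model L0 S)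
    (x : S) (A : formula L0) : Prop :=
  upset_set (truth_set (@nbhd_interior S) M A) x.

Definition interior_entails (L0 : Type) (Gamma : set (formula L0))
    (A : formula L0) : Prop :=
  forall (M : interior_preorder_model L0) (x : M),
    (forall B, Gamma B -> interior_forces x B) -> interior_forces x A.

Definition nbhd_entails (L0 : Type) (Gamma : set (formula L0))
    (A : formula L0) : Prop :=
  forall (S : nbhd_system), coherent S ->
  forall (M : nbhd_model L0 S) (x : S),
    (forall B, Gamma B -> nbhd_forces M x B) -> nbhd_forces M x A.

(* Main.v *)
Require Import Defs.
From mathcomp Require Import all_boot.
From mathcomp Require Import boolp classical_sets.

(** Soundness is an induction on derivations. For completeness, take the prime
    theories ordered by inclusion and write [hat B] for the set of those that
    contain [B]. Put [i U] for the union of the sets [hat (Box B)] over all [B]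
    with [hat B] contained in [U]. The axioms (T), (4), (K) and rule (G) give
    (I1)-(I4); since [hat B] is contained in [hat A] only if [B ==> A] is
    derivable, [i (hat A) = hat (Box A)], which is the only new case of the
    truth lemma. Interior frames and coherent systems correspond to each other
    through [U \in N_x <-> x \in i U]. *)

Set Implicit Arguments.
Unset Strict Implicit.
Unset Printing Implicit Defensive.

Local Open Scope classical_set_scope.

(** * Interior preorder frames versus coherent neighbourhood systems *)

Lemma upset_ext (X : preordered_set) (U V : upset X) :
  U = V :> set X -> U = V.
Proof.
case: U V => [U hU] [V hV] /= UV.
by case: _ / UV hV => hV; congr Upset; exact: Prop_irrelevance.
Qed.

Lemma le_refl (X : preordered_set) (x : X) : le x x.
Proof. exact: (@PreOrder_Reflexive _ _ (le_preorder X)). Qed.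

Lemma le_trans (X : preordered_set) (x y z : X) : le x y -> le y z -> le x z.
Proof. exact: (@PreOrder_Transitive _ _ (le_preorder X)). Qed.

Definition system_of_frame (F : interior_preorder_frame) : nbhd_system :=
  @NbhdSystem F (fun x => [set U | upset_set (interior U) x])
    (fun x y xy U Ux => upsetP Ux xy).

Lemma nbhd_interior_of_frame (F : interior_preorder_frame) :
  @nbhd_interior (system_of_frame F) = @interior F.
Proof. by apply: funext => U; apply: upset_ext. Qed.

Lemma coherent_of_frame (F : interior_preorder_frame) :
  coherent (system_of_frame F).
Proof.
split.
- move=> x; split.
    by exists (upsetT F); rewrite /= interior_I4.
  by move=> U V; rewrite /= interior_I3.
- by rewrite nbhd_interior_of_frame; exact: interior_I1.
- by rewrite nbhd_interior_of_frame; exact: interior_I2.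
Qed.

Lemma nbhd_interior_I3 (S : nbhd_system) :
  filtered S -> I3 (@nbhd_interior S).
Proof.
by move=> fS U V; apply/seteqP; split=> x /=; case: (fS x) => _ /(_ U V) [].
Qed.

(** Any member [U] of [nbhd x] equals its intersection with the whole space, so the filter clause,
    read from right to left, puts [upsetT S] in [nbhd x]. *)
Lemma nbhd_interior_I4 (S : nbhd_system) :
  filtered S -> I4 (@nbhd_interior S).
Proof.
move=> fS; apply/seteqP; split=> x //= _.
have [[U xU] xI] := fS x.
have UT : upsetI U (upsetT S) = U by apply: upset_ext; rewrite /= setIT.
by have [] := (xI U (upsetT S)).2; rewrite ?UT.
Qed.

Lemma interior_nbhd_entails (L0 : Type) (Gamma : set (formula L0)) A :
  interior_entails Gamma A <-> nbhd_entails Gamma A.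
Proof.
split=> [GA S [fS S1 S2] M | GA [F v] x Gx].
  exact: (GA (@InteriorPreorderModel L0 (InteriorPreorderFrame S1 S2
    (nbhd_interior_I3 fS) (nbhd_interior_I4 fS)) M)).
have := GA _ (coherent_of_frame F) v x.
by rewrite /nbhd_forces nbhd_interior_of_frame; apply.
Qed.

(** * Soundness for interior preorder frames *)

Section Soundness.
Variable L0 : Type.
Implicit Types A B : formula L0.

Lemma truth_set_subst (X : preordered_set) (i : upset X -> upset X)
    (v : L0 -> upset X) s A :
  truth_set i v (subst s A) = truth_set i (fun p => truth_set i v (s p)) A.
Proof. by elim: A => //= [A -> B ->|A -> B ->|A -> B ->|A ->]. Qed.

Lemma interior_mono (F : interior_preorder_frame) (U V : upset F) :
  U `<=` V -> interior U `<=` interior V.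
Proof.
move=> UV x Ux.
(* Monotonicity is read off (I3), because inclusion amounts to [U] being its own intersection with
   [V]. *)
have UVU : upsetI U V = U by apply: upset_ext; exact/setIidl.
by have := interior_I3 U V; rewrite UVU => UE; rewrite UE in Ux; case: Ux.
Qed.

Lemma axiom_valid (F : interior_preorder_frame) (v : L0 -> upset F) A x :
  iS4h_axiom A -> upset_set (truth_set (@interior F) v A) x.
Proof.
case=> /=.
- by move=> p q y _ py z yz _; exact: upsetP py yz.
- move=> p q r y _ pqr z yz pq w zw pw.
  by apply: (pqr w (le_trans yz zw) pw w (le_refl w)); exact: pq.
- by move=> p q y _; left.
- by move=> p q y _; right.
- move=> p q r y _ pr z yz qr w zw [pw|qw]; last exact: qr.
  by apply: pr => //; exact: le_trans zw.
- by move=> p q y _ [].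
- by move=> p q y _ [].
- move=> p q r y _ pq z yz pr w zw pw.
  by split; [apply: pq => //; exact: le_trans zw | exact: pr].
- by [].
- move=> p q y _ pqy z yz pz.
  have pqz := upsetP pqy yz.
  (* (I3) merges the two boxed facts into one interior, inside which modus ponens is an inclusion of
     upsets. *)
  have : upset_set (interior (upsetI (upset_rhd (v p) (v q)) (v p))) z.
    by rewrite interior_I3.
  apply: interior_mono => w [pqw pw]; exact: pqw (le_refl w) pw.
- by move=> p y _; exact: interior_I1.
- by move=> p y _; exact: interior_I2.
Qed.

Lemma soundness (Gamma : set (formula L0)) A :
  derives Gamma A -> interior_entails Gamma A.
Proof.
elim=> {Gamma A}.
- by move=> Gamma A axA M x _; exact: axiom_valid.
- by move=> Gamma A GA M x; apply.
- move=> Gamma A B _ IA _ IAB M x Gx.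
  exact: (IAB M x Gx x (le_refl _) (IA M x Gx)).
- move=> Gamma A s _ IA [F v] x _.
  rewrite /interior_forces truth_set_subst.
  (* The premise of [rule_US] has no hypotheses, so its induction hypothesis holds under every
     valuation, in particular under [w], which absorbs the substitution. *)
  pose w p := truth_set (@interior F) v (s p).
  by apply: (IA (@InteriorPreorderModel L0 F w) x).
- move=> Gamma A _ IA M x _.
  rewrite /interior_forces /=.
  have : upset_set (interior (upsetT M)) x by rewrite interior_I4.
  by apply: interior_mono => y _; apply: IA.
Qed.

End Soundness.

(** * Completeness: arbitrary instances of the axioms *)

Section Completeness.
Variable L0 : countType.
Hypothesis three_vars : exists p q r : L0, [/\ p <> q, p <> r & q <> r].
Implicit Types (A B C : formula L0) (Gamma Delta : set (formula L0)).

(* An axiom in three distinct variables yields all its instances. *)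
Lemma three_vars_subst A B C : exists p q r (s : L0 -> formula L0),
  [/\ s p = A, s q = B & s r = C].
Proof.
case: three_vars => p [q [r [/eqP pq /eqP pr /eqP qr]]].
exists p, q, r, (fun t => if t == p then A else if t == q then B else C).
by rewrite !eqxx [q == p]eq_sym [r == p]eq_sym [r == q]eq_sym
   (negbTE pq) (negbTE pr) (negbTE qr).
Qed.

Lemma derives_A1 Gamma A B : derives Gamma (A ==> (B ==> A)).
Proof.
have [p [q [r [s [sp sq _]]]]] := three_vars_subst A B A.
by have := rule_US Gamma s (rule_Ax _ (ax_A1 p q)); rewrite /= sp sq.
Qed.

Lemma derives_A2 Gamma A B C :
  derives Gamma ((A ==> (B ==> C)) ==> ((A ==> B) ==> (A ==> C))).
Proof.
have [p [q [r [s [sp sq sr]]]]] := three_vars_subst A B C.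
by have := rule_US Gamma s (rule_Ax _ (ax_A2 p q r)); rewrite /= sp sq sr.
Qed.

Lemma derives_A3 Gamma A B : derives Gamma (A ==> (A || B)).
Proof.
have [p [q [r [s [sp sq _]]]]] := three_vars_subst A B A.
by have := rule_US Gamma s (rule_Ax _ (ax_A3 p q)); rewrite /= sp sq.
Qed.

Lemma derives_A4 Gamma A B : derives Gamma (B ==> (A || B)).
Proof.
have [p [q [r [s [sp sq _]]]]] := three_vars_subst A B A.
by have := rule_US Gamma s (rule_Ax _ (ax_A4 p q)); rewrite /= sp sq.
Qed.

Lemma derives_A5 Gamma A B C :
  derives Gamma ((A ==> C) ==> ((B ==> C) ==> ((A || B) ==> C))).
Proof.
have [p [q [r [s [sp sq sr]]]]] := three_vars_subst A B C.
by have := rule_US Gamma s (rule_Ax _ (ax_A5 p q r)); rewrite /= sp sq sr.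
Qed.

Lemma derives_A6 Gamma A B : derives Gamma ((A && B) ==> A).
Proof.
have [p [q [r [s [sp sq _]]]]] := three_vars_subst A B A.
by have := rule_US Gamma s (rule_Ax _ (ax_A6 p q)); rewrite /= sp sq.
Qed.

Lemma derives_A7 Gamma A B : derives Gamma ((A && B) ==> B).
Proof.
have [p [q [r [s [sp sq _]]]]] := three_vars_subst A B A.
by have := rule_US Gamma s (rule_Ax _ (ax_A7 p q)); rewrite /= sp sq.
Qed.

Lemma derives_A8 Gamma A B C :
  derives Gamma ((A ==> B) ==> ((A ==> C) ==> (A ==> (B && C)))).
Proof.
have [p [q [r [s [sp sq sr]]]]] := three_vars_subst A B C.
by have := rule_US Gamma s (rule_Ax _ (ax_A8 p q r)); rewrite /= sp sq sr.
Qed.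

Lemma derives_A9 Gamma A : derives Gamma (Bot ==> A).
Proof.
have [p [q [r [s [sp _ _]]]]] := three_vars_subst A A A.
by have := rule_US Gamma s (rule_Ax _ (ax_A9 p)); rewrite /= sp.
Qed.

Lemma derives_K Gamma A B :
  derives Gamma (Box (A ==> B) ==> (Box A ==> Box B)).
Proof.
have [p [q [r [s [sp sq _]]]]] := three_vars_subst A B A.
by have := rule_US Gamma s (rule_Ax _ (ax_K p q)); rewrite /= sp sq.
Qed.

Lemma derives_T Gamma A : derives Gamma (Box A ==> A).
Proof.
have [p [q [r [s [sp _ _]]]]] := three_vars_subst A A A.
by have := rule_US Gamma s (rule_Ax _ (ax_T p)); rewrite /= sp.
Qed.

Lemma derives_4 Gamma A : derives Gamma (Box A ==> Box (Box A)).
Proof.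
have [p [q [r [s [sp _ _]]]]] := three_vars_subst A A A.
by have := rule_US Gamma s (rule_Ax _ (ax_4 p)); rewrite /= sp.
Qed.

(** * Structural rules and the deduction theorem *)

Lemma derives_weaken Gamma Delta A :
  Gamma `<=` Delta -> derives Gamma A -> derives Delta A.
Proof.
move=> + GA; elim: GA Delta => {Gamma A}.
- by move=> Gamma A axA Delta _; exact: rule_Ax.
- by move=> Gamma A GA Delta GD; apply: rule_C; exact: GD.
- by move=> Gamma A B _ IA _ IAB Delta GD; exact: rule_MP (IA _ GD) (IAB _ GD).
- by move=> Gamma A s A0 _ Delta _; exact: rule_US.
- by move=> Gamma A A0 _ Delta _; exact: rule_G.
Qed.

Lemma derives_id Gamma A : derives Gamma (A ==> A).
Proof.
(* The combinator term [S K K]. *)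
apply: rule_MP (derives_A1 _ A A) _.
exact: rule_MP (derives_A1 _ A (A ==> A)%F) (derives_A2 _ _ _ _).
Qed.

(** [rule_US] and [rule_G] do not obstruct the discharge of [A]: their premises are derived from
    [set0], so their conclusions already hold over [Gamma], and [derives_A1] prefixes [A]. *)
Lemma deduction Gamma A B :
  derives (Gamma `|` [set A]) B -> derives Gamma (A ==> B).
Proof.
move DE: (Gamma `|` [set A]) => D DB; elim: DB DE => {D B}.
- by move=> D B axB _; apply: rule_MP (derives_A1 _ _ _); exact: rule_Ax.
- move=> D B + DE; rewrite -DE => -[GB|->]; last exact: derives_id.
  by apply: rule_MP (derives_A1 _ _ _); exact: rule_C.
- move=> D B C _ IB _ IBC DG.
  exact: rule_MP (IB DG) (rule_MP (IBC DG) (derives_A2 _ _ _ _)).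
- by move=> D B s B0 _ _; apply: rule_MP (derives_A1 _ _ _); exact: rule_US.
- by move=> D B B0 _ _; apply: rule_MP (derives_A1 _ _ _); exact: rule_G.
Qed.

Lemma derives_cut Gamma A B :
  derives Gamma A -> derives (Gamma `|` [set A]) B -> derives Gamma B.
Proof. by move=> GA /deduction; exact: rule_MP. Qed.

Lemma derives_or_elim Gamma A B C : derives Gamma (A || B) ->
  derives (Gamma `|` [set A]) C -> derives (Gamma `|` [set B]) C ->
  derives Gamma C.
Proof.
move=> AB /deduction AC /deduction BC; apply: rule_MP AB _.
exact: rule_MP BC (rule_MP AC (derives_A5 _ _ _ _)).
Qed.

Lemma derives_and Gamma A B :
  derives Gamma A -> derives Gamma B -> derives Gamma (A && B).
Proof.
move=> GA GB.
have AA : derives Gamma (A ==> A) by exact: derives_id.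
have AB : derives Gamma (A ==> B) by exact: rule_MP GB (derives_A1 _ _ _).
exact: rule_MP GA (rule_MP AB (rule_MP AA (derives_A8 _ _ _ _))).
Qed.

(** * Prime theories *)

(** Compactness along a chain: of the two members used by the premises of [rule_MP], the larger
    serves both. The first alternative covers the empty chain, which has no member to offer. *)
Lemma derives_chain Gamma (F : set (set (formula L0))) A :
  total_on F subset -> derives (Gamma `|` \bigcup_(D in F) D) A ->
  derives Gamma A \/ exists2 D, F D & derives (Gamma `|` D) A.
Proof.
move=> Ftot; move HE: (_ `|` _) => H HA; elim: HA HE => {H A}.
- by move=> H A axA _; left; exact: rule_Ax.
- move=> H A + HE; rewrite -HE => -[GA|[D FD DA]]; first by left; exact: rule_C.
  by right; exists D => //; apply: rule_C; right.
- move=> H A B _ IA _ IAB HG.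
  have wl D C : derives Gamma C -> derives (Gamma `|` D) C.
    by apply: derives_weaken; exact: subsetUl.
  have wr D E C : D `<=` E ->
      derives (Gamma `|` D) C -> derives (Gamma `|` E) C.
    by move=> DE; apply: derives_weaken; exact: setUS.
  case: (IA HG) (IAB HG) => [GA|[D FD DA]] [GAB|[E FE EAB]].
  + by left; exact: rule_MP GA GAB.
  + by right; exists E => //; apply: rule_MP EAB; exact: wl.
  + by right; exists D => //; apply: rule_MP DA _; exact: wl.
  + case: (Ftot D E FD FE) => DE; right.
      by exists E => //; apply: rule_MP EAB; exact: wr DA.
    by exists D => //; apply: rule_MP DA _; exact: wr EAB.
- by move=> H A s A0 _ _; left; exact: rule_US.
- by move=> H A A0 _ _; left; exact: rule_G.
Qed.

Definition prime_theory Delta : Prop :=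
  [/\ forall B, derives Delta B -> Delta B, ~ Delta Bot &
      forall B C, Delta (B || C)%F -> Delta B \/ Delta C].

Lemma prime_extension Gamma A : ~ derives Gamma A ->
  exists Delta, [/\ prime_theory Delta, Gamma `<=` Delta & ~ Delta A].
Proof.
move=> GA.
(* Zorn runs over the sets added to [Gamma] rather than over supersets of [Gamma], so that the empty
   union is admissible too. *)
have [|D [DA Dmax]] := @Zorn_bigcup _ [set D | ~ derives (Gamma `|` D) A].
  move=> F FP Ftot /(derives_chain Ftot) [//|[D FD]]; exact: FP.
pose E := Gamma `|` D.
(* By maximality of [D], adjoining any formula outside [E] makes [A] derivable; closure under
   derivation and primeness both follow from this. *)
have max B : ~ E B -> derives (E `|` [set B]) A.
  move=> EB; apply: contrapT => nA; apply: (Dmax (D `|` [set B])).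
    split=> [|/(_ B) DB]; first exact: subsetUl.
    by apply: EB; right; apply: DB; right.
  by rewrite /= setUA.
have clE B : derives E B -> E B.
  by move=> dB; apply: contrapT => /max; exact: contra_not (derives_cut dB) DA.
exists E; split; [split=> // | exact: subsetUl | by move=> /(rule_C (A := A))].
- by move=> /rule_C EB; apply: DA; exact: rule_MP EB (derives_A9 _ _).
- move=> B C EBC; apply: contrapT => /not_orP [/max BA /max CA].
  by apply: DA; apply: derives_or_elim BA CA; exact: rule_C.
Qed.

(** * The canonical interior preorder frame *)

Definition theories : Type := {Delta | prime_theory Delta}.

Definition theory_le (x y : theories) : Prop := sval x `<=` sval y.

Lemma theory_le_preorder : PreOrder theory_le.
Proof. by split=> [x|x y z]; [exact: subset_refl | exact: subset_trans]. Qed.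

Definition canonical_preorder := PreorderedSet theory_le_preorder.

Definition hat A : upset canonical_preorder :=
  @Upset canonical_preorder [set x | sval x A] (fun x y xA xy => xy A xA).

Lemma theory_derives (x : canonical_preorder) A :
  derives (sval x) A -> sval x A.
Proof. by move: A; case: x => D []. Qed.

Lemma theory_MP (x : canonical_preorder) A B :
  sval x A -> derives (sval x) (A ==> B) -> sval x B.
Proof.
by move=> xA AB; apply: theory_derives; exact: rule_MP (rule_C xA) AB.
Qed.

(** Otherwise [prime_extension] separates: some prime theory contains [A] but omits [B]. *)
Lemma hat_sub A B : hat A `<=` hat B -> derives set0 (A ==> B).
Proof.
move=> AB; apply: deduction; apply: contrapT => /prime_extension.
move=> [D [pD AD DB]]; apply: DB.
by apply: (AB (exist _ D pD)); apply: AD; right.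
Qed.

Lemma derives_Box_mono Gamma A B :
  derives set0 (A ==> B) -> derives Gamma (Box A ==> Box B).
Proof. by move=> AB; apply: rule_MP (derives_K _ _ _); exact: rule_G. Qed.

Lemma is_upset_canonical_interior (U : upset canonical_preorder) :
  is_upset [set x : canonical_preorder |
    exists2 B, hat B `<=` U & sval x (Box B)].
Proof. by move=> x y [B BU xB] xy; exists B => //; exact: xy. Qed.

(** An interior is needed on all upsets, not only on the sets [hat A]; each [U] is approximated from
    inside by the [hat B] it contains. *)
Definition canonical_interior (U : upset canonical_preorder) :
    upset canonical_preorder :=
  Upset (@is_upset_canonical_interior U).

Lemma canonical_I1 : I1 canonical_interior.
Proof.
by move=> U x [B BU xB]; apply: BU; exact: theory_MP xB (derives_T _ _).
Qed.

Lemma canonical_I2 : I2 canonical_interior.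
Proof.
(* The witness is [Box B]: by construction [hat (Box B)] lies inside the interior of [U]. *)
move=> U x [B BU xB]; exists (Box B); last exact: theory_MP xB (derives_4 _ _).
by move=> y yB; exists B.
Qed.

Lemma canonical_I3 : I3 canonical_interior.
Proof.
move=> U V; apply/seteqP; split=> x /=.
  by move=> [B BUV xB]; split; exists B => // y /BUV [].
move=> [[B BU xB] [C CV xC]]; exists (B && C)%F.
  move=> y yBC; split.
    by apply: BU; exact: theory_MP yBC (derives_A6 _ _ _).
  by apply: CV; exact: theory_MP yBC (derives_A7 _ _ _).
(* The curried form lets [Box B] and then [Box C] be detached in turn by means of (K). *)
have BC : derives set0 (B ==> (C ==> (B && C))).
  apply: deduction; apply: deduction.
  by apply: derives_and; apply: rule_C; [left; right | right].
apply: (theory_MP xC); apply: rule_MP (derives_K _ _ _).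
by apply: rule_C; exact: theory_MP xB (derives_Box_mono _ BC).
Qed.

Lemma canonical_I4 : I4 canonical_interior.
Proof.
(* The witness is a theorem, so by [rule_G] its box belongs to every theory. *)
apply/seteqP; split=> x //= _; exists (Bot ==> Bot)%F => //.
by apply: theory_derives; apply: rule_G; exact: derives_id.
Qed.

Definition canonical_frame :=
  InteriorPreorderFrame canonical_I1 canonical_I2 canonical_I3 canonical_I4.

(** * The truth lemma and completeness *)

Lemma hat_Or A B : upsetU (hat A) (hat B) = hat (A || B).
Proof.
apply: upset_ext; apply/seteqP; split=> x /=.
  move=> [xA|xB]; first exact: theory_MP xA (derives_A3 _ _ _).
  exact: theory_MP xB (derives_A4 _ _ _).
by case: x => D pD /=; case: pD => _ _; apply.
Qed.

Lemma hat_And A B : upsetI (hat A) (hat B) = hat (A && B).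
Proof.
apply: upset_ext; apply/seteqP; split=> x /=.
  by move=> [xA xB]; apply: theory_derives; apply: derives_and; exact: rule_C.
move=> xAB; split; first exact: theory_MP xAB (derives_A6 _ _ _).
exact: theory_MP xAB (derives_A7 _ _ _).
Qed.

Lemma hat_Imp A B : upset_rhd (hat A) (hat B) = hat (A ==> B).
Proof.
apply: upset_ext; apply/seteqP; split=> x /=; last first.
  by move=> xAB y xy yA; apply: (theory_MP yA); apply: rule_C; exact: xy.
(* If [B] did not follow from [x] together with [A], a prime theory above [x] would contain [A] and
   omit [B], against [xAB]. *)
move=> xAB; apply: theory_derives; apply: deduction; apply: contrapT.
move=> /prime_extension [D [pD AD]]; apply.
by apply: (xAB (exist _ D pD)) => [C xC|]; apply: AD; [left | right].
Qed.

Lemma hat_Box A : canonical_interior (hat A) = hat (Box A).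
Proof.
apply: upset_ext; apply/seteqP; split=> x /=; last by exists A.
move=> [B /hat_sub BA xB]; exact: theory_MP xB (derives_Box_mono _ BA).
Qed.

Lemma truth_lemma A : truth_set canonical_interior (hat \o @Var L0) A = hat A.
Proof.
elim: A => //= [|A -> B ->|A -> B ->|A -> B ->|A ->].
- by apply: upset_ext; apply/seteqP; split=> [//|[D []]].
- exact: hat_Or.
- exact: hat_And.
- exact: hat_Imp.
- exact: hat_Box.
Qed.

Lemma completeness Gamma A : interior_entails Gamma A -> derives Gamma A.
Proof.
(* The prime theory [D] that contains [Gamma] and omits [A] is the refuting point of the canonical
   model. *)
move=> GA; apply: contrapT => /prime_extension [D [pD GD]]; apply.
have := GA (@InteriorPreorderModel L0 canonical_frame (hat \o @Var L0))
  (exist _ D pD).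
rewrite /interior_forces /= truth_lemma; apply => B /GD.
by rewrite truth_lemma.
Qed.

End Completeness.

(* L0 has at least three elements, since the axioms are stated with three
   distinct propositional variables. *)
Theorem corollary5p14 (L0 : countType)
    (three_vars : exists p q r : L0, [/\ p <> q, p <> r & q <> r])
    (Gamma : set (formula L0)) (A : formula L0) :
  (derives Gamma A <-> interior_entails Gamma A) /\
  (interior_entails Gamma A <-> nbhd_entails Gamma A).
Proof.
split; last exact: interior_nbhd_entails.
by split; [exact: soundness | exact: completeness].
Qed.
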